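(* Let $G=(V,E)$ be a vertex-capacitated graph with $n=|V|$, let $A$ be a node-weighting of $G$, and let $h>1$, $\phi<1$ and a length slack parameter $s=O(\log n)$ be given. Then there is an $(h,s)$-length $\phi$-expander decomposition for $A$ with cut slack $\kappa=O(n^{O(1/s)}\log n)$; that is, there is an $h\cdot s$-length moving cut $C$ of $G$ with $|C|\le\kappa\cdot\phi\cdot|A|$ such that $A$ is $(h,s)$-length $\phi$-expanding in $G-C$ (the $O(\cdot)$'s hide absolute constants).
   Context: A vertex-capacitated graph is a finite undirected graph $G=(V,E)$ with a length function $\ell:V\cup E\to\mathbb{Z}_{>0}$ and a capacity function $u:V\cup E\to\mathbb{Z}_{>0}$, all values bounded by $N=\mathrm{poly}(n)$. The length of a simple path is the sum of the lengths of its vertices and edges; $\mathrm{dist}_G(v,w)$ is the minimum length of a $v$–$w$ path. A node-weighting is $A:V\to\mathbb{R}_{\ge 0}$, $|A|=\sum_vA(v)$. A demand is $D:V\times V\to\mathbb{R}_{\ge0}$; it is $A$-respecting if $\max\{\sum_wD(v,w),\sum_wD(w,v)\}\le A(v)$ for all $v$, and $h$-length if $D(v,w)>0$ implies $\mathrm{dist}_G(v,w)\le h$. For $H>0$, an $H$-length moving cut is $C:V\cup E\to\{0,\tfrac1H,\tfrac2H,\dots\}\cap[0,1]$, of size $|C|=\sum_e u(e)C(e)+\sum_v u(v)C(v)$; $G-C$ is $G$ with every vertex/edge length $\ell(x)$ increased to $\ell(x)+H\cdot C(x)$. For $h'>0$, $\mathrm{sep}_{h'}(C,D)=\sum_{(u,v):\mathrm{dist}_{G-C}(u,v)>h'}D(u,v)$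 and, when positive, $\mathrm{spars}_{h'}(C,D)=|C|/\mathrm{sep}_{h'}(C,D)$. For an $hs$-length moving cut $C$, $\mathrm{spars}_{(h,s)}(C,A)$ is the minimum of $\mathrm{spars}_{hs}(C,D)$ over all $A$-respecting $h$-length demands $D$ (zero separation counts as $+\infty$). The $(h,s)$-length conductance of $A$ is the minimum of $\mathrm{spars}_{(h,s)}(C,A)$ over all $hs$-length moving cuts $C$, and $A$ is $(h,s)$-length $\phi$-expanding if this conductance is at least $\phi$ (evaluated in the graph in question).
   Formalization: The formal statement assumes length slack s ≥ 1 and φ > 0; for s < 1 the claim can fail (a vertex of length between hs and h gives a self-demand separated by the zero cut), and for φ < 0 the bound on |C| is negative. *)

(* Defs.v *)
From HB Require Import structures.
From mathcomp Require Import all_boot all_order all_algebra.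
From mathcomp Require Import boolp classical_sets reals exp.
Set Implicit Arguments. Unset Strict Implicit. Unset Printing Implicit Defensive.
Import Order.TTheory GRing.Theory Num.Theory.
Local Open Scope ring_scope.

Section VCGraph.
Variable R : realType.
Variable V : finType.

Definition is_edge_set (E : {set {set V}}) : Prop :=
  forall e, e \in E -> #|e| = 2%N.

Definition adj (E : {set {set V}}) (u v : V) : bool :=
  (u != v) && ([set u; v] \in E).

Definition spath (E : {set {set V}}) (v : V) (p : seq V) (w : V) : Prop :=
  [/\ path (adj E) v p, uniq (v :: p) & last v p = w].

Definition plen (lv : V -> R) (le : {set V} -> R) (v : V) (p : seq V) : R :=
  \sum_(x <- v :: p) lv x + \sum_(ab <- zip (v :: p) p) le [set ab.1; ab.2].

(* dist(v,w) <= h  (dist is the minimum over simple paths, +oo if none) *)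
Definition dist_le E lv le (v w : V) (h : R) : Prop :=
  exists p, spath E v p w /\ plen lv le v p <= h.

Definition dist_gt E lv le (v w : V) (h : R) : Prop :=
  forall p, spath E v p w -> h < plen lv le v p.

Definition moving_cut (E : {set {set V}}) (H : R)
    (CV : V -> R) (CE : {set V} -> R) : Prop :=
  (forall v, (exists k : nat, CV v = k%:R / H) /\ 0 <= CV v <= 1) /\
  (forall e, e \in E -> (exists k : nat, CE e = k%:R / H) /\ 0 <= CE e <= 1).

Definition cut_size (E : {set {set V}}) (uV : V -> R) (uE : {set V} -> R)
    (CV : V -> R) (CE : {set V} -> R) : R :=
  \sum_(e in E) uE e * CE e + \sum_v uV v * CV v.

Definition cutV (H : R) (lv : V -> R) (CV : V -> R) : V -> R :=
  fun v => lv v + H * CV v.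
Definition cutE (H : R) (le : {set V} -> R) (CE : {set V} -> R) : {set V} -> R :=
  fun e => le e + H * CE e.

Definition node_weighting (A : V -> R) : Prop := forall v, 0 <= A v.

Definition weight (A : V -> R) : R := \sum_v A v.

Definition demand (D : V -> V -> R) : Prop := forall v w, 0 <= D v w.

Definition respecting (A : V -> R) (D : V -> V -> R) : Prop :=
  forall v, \sum_w D v w <= A v /\ \sum_w D w v <= A v.

Definition h_length E lv le (h : R) (D : V -> V -> R) : Prop :=
  forall v w, 0 < D v w -> dist_le E lv le v w h.

(* sep_{h'}(C, D), where lv, le are already the lengths of G - C *)
Definition sep E lv le (h' : R) (D : V -> V -> R) : R :=
  \sum_u \sum_w (if `[< dist_gt E lv le u w h' >] then D u w else 0).

Definition expanding E (lv : V -> R) (le : {set V} -> R)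
    (uV : V -> R) (uE : {set V} -> R) (A : V -> R) (h s phi : R) : Prop :=
  forall (CV : V -> R) (CE : {set V} -> R) (D : V -> V -> R),
    moving_cut E (h * s) CV CE ->
    demand D -> respecting A D -> h_length E lv le h D ->
    0 < sep E (cutV (h * s) lv CV) (cutE (h * s) le CE) (h * s) D ->
    phi <= cut_size E uV uE CV CE /
           sep E (cutV (h * s) lv CV) (cutE (h * s) le CE) (h * s) D.

End VCGraph.

(* Main.v *)
Require Import Defs.
From HB Require Import structures.
From mathcomp Require Import all_boot all_order all_algebra.
From mathcomp Require Import boolp classical_sets reals exp.
From mathcomp Require Import zify ring lra.
Import Order.TTheory GRing.Theory Num.Theory.
Local Open Scope ring_scope.
Set Implicit Arguments. Unset Strict Implicit. Unset Printing Implicit Defensive.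

(** Let [H = h * s], round distances to multiples of [h] (truncated above [s]), and
    put [Z v = \sum_w q ^ d(v, w)] with [q = (2 n) ^ (- 4 / s)].  When a cut takes a
    pair [u, v] from distance at most [h] to distance more than [h * s], the balls
    around [u] and [v] in the new graph essentially do not overlap, while in the old
    graph [u] and [v] are adjacent; hence the old [Z u] is at least the new
    [Z u + (q / 2) Z v], and symmetrically for [v].  Whichever of the two had the
    smaller mass loses a constant times [q] in [ln Z].  So, up to a term for
    self-demands, [f = (8 / q) ln Z] is a vertex potential between [0] and
    [(8 / q) ln n] such that a cut separating an [A]-respecting [h]-length demand
    decreases [\sum_v A v * f v] by at least the separated amount.  A cut [C]
    minimising [|C| + phi * \sum_v A v * f v] is then small, by comparison with the
    empty cut, and [G - C] has no [phi]-sparse cut, which could be added to [C]. *)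

(** * Path distances *)

Section Distances.
Variables (R : realType) (V : finType) (E : {set {set V}}).
Implicit Types (lv : V -> R) (le : {set V} -> R) (u v w : V) (p q : seq V).

Lemma adjC u v : adj E u v = adj E v u.
Proof. by rewrite /adj eq_sym finset.setUC. Qed.

Lemma plen_nil lv le v : plen lv le v [::] = lv v.
Proof. by rewrite /plen /= big_seq1 big_nil addr0. Qed.

Lemma plen_cons lv le v x p :
  plen lv le v (x :: p) = lv v + le [set v; x]%SET + plen lv le x p.
Proof. by rewrite /plen /= !big_cons /=; ring. Qed.

Lemma ler_plen lv lv' le le' v p :
  (forall x, lv x <= lv' x) -> (forall e, e \in E -> le e <= le' e) ->
  path (adj E) v p -> plen lv le v p <= plen lv' le' v p.
Proof.
move=> hv he; elim: p v => [|x p IH] v /=; first by rewrite !plen_nil.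
by move=> /andP[/andP[_ /he hvx] /IH]; rewrite !plen_cons; move: (hv v); lra.
Qed.

Lemma dist_leW lv lv' le le' v w r r' :
  (forall x, lv x <= lv' x) -> (forall e, e \in E -> le e <= le' e) ->
  r <= r' -> dist_le E lv' le' v w r -> dist_le E lv le v w r'.
Proof.
move=> hv he hr [p [[pp up lp] lep]]; exists p; split=> //.
by apply: le_trans (ler_plen hv he pp) _; apply: le_trans hr.
Qed.

Lemma dist_gtP lv le v w r :
  dist_gt E lv le v w r <-> ~ dist_le E lv le v w r.
Proof.
split=> [hgt [p [/hgt + hle]]|hn p sp]; first by rewrite ltNge hle.
by rewrite ltNge; apply/negP => hle; apply: hn; exists p.
Qed.

Section Nonnegative.
Variables (lv : V -> R) (le : {set V} -> R).
Hypotheses (lv_ge0 : forall x, 0 <= lv x) (le_ge0 : forall e, 0 <= le e).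

Lemma plen_ge v p : lv v <= plen lv le v p.
Proof.
elim: p v => [|x p IH] v; first by rewrite plen_nil.
by rewrite plen_cons; move: (IH x) (lv_ge0 x) (le_ge0 [set v; x]%SET); lra.
Qed.

Lemma plen_suffix v p1 x p2 : plen lv le x p2 <= plen lv le v (p1 ++ x :: p2).
Proof.
elim: p1 v => [|y p1 IH] v /=; rewrite plen_cons.
  by move: (lv_ge0 v) (le_ge0 [set v; x]%SET); lra.
by move: (IH y) (lv_ge0 v) (le_ge0 [set v; y]%SET); lra.
Qed.

(** Loop erasure: if [v] already lies on the simple path found for the tail, only the suffix
    starting at [v] is kept, which costs no more since lengths are nonnegative. *)
Lemma walk_dist_le v p :
  path (adj E) v p -> dist_le E lv le v (last v p) (plen lv le v p).
Proof.
elim: p v => [|x p IH] v /=; first by exists [::]; split.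
case/andP=> avx /IH[p' [[pp' up' lp'] hp']]; rewrite plen_cons.
have [vp'|nvp'] := boolP (v \in x :: p'); last first.
  exists (x :: p'); split; first by split=> //=; [rewrite avx | rewrite nvp'].
  by rewrite plen_cons lerD2l.
suff [p2 [sp2 hp2]] :
    exists p2, spath E v p2 (last x p) /\ plen lv le v p2 <= plen lv le x p'.
  by exists p2; split=> //; move: (lv_ge0 v) (le_ge0 [set v; x]%SET); lra.
move: vp'; rewrite inE => /predU1P[->|vp']; first by exists p'.
case/splitPr: {p'}vp' pp' up' lp' {hp'} => p1 p2; rewrite cat_path last_cat /=.
case/and3P=> _ _ pp2 /andP[_ up2] lp2; exists p2; split; last exact: plen_suffix.
by split=> //; move: up2; rewrite cat_uniq => /and3P[].
Qed.

Lemma plen_cat v p q :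
  plen lv le v (p ++ q) = plen lv le v p + plen lv le (last v p) q - lv (last v p).
Proof.
elim: p v => [|x p IH] v /=; first by rewrite plen_nil; ring.
by rewrite !plen_cons IH; ring.
Qed.

Lemma dist_le_trans v u w a b :
  dist_le E lv le v u a -> dist_le E lv le u w b -> dist_le E lv le v w (a + b).
Proof.
move=> [p [[pp _ lp] hp]] [q [[pq _ lq] hq]].
have pc : path (adj E) v (p ++ q) by rewrite cat_path pp lp.
have := walk_dist_le pc; rewrite last_cat lp lq; apply: dist_leW => //.
by rewrite plen_cat lp; move: (lv_ge0 u); lra.
Qed.

Lemma rev_walk v p : path (adj E) v p ->
  exists q, [/\ path (adj E) (last v p) q, last (last v p) q = v
              & plen lv le (last v p) q = plen lv le v p].
Proof.
elim: p v => [|x p IH] v /=; first by exists [::].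
case/andP=> avx /IH[q [pq lq hq]]; exists (q ++ [:: v]).
rewrite cat_path last_cat /= lq pq adjC avx plen_cat lq hq !plen_cons plen_nil.
by rewrite [[set x; v]%SET]finset.setUC; split=> //; ring.
Qed.

Lemma dist_leC v w r : dist_le E lv le v w r -> dist_le E lv le w v r.
Proof.
move=> [p [[pp _ <-] hp]]; have [q [pq lq hq]] := rev_walk pp.
by have := walk_dist_le pq; rewrite lq hq; apply: dist_leW.
Qed.

End Nonnegative.
End Distances.

(** * Rounded distances *)

Section RoundedDistance.
Variables (R : realType) (V : finType) (E : {set {set V}}).
Variables (lv : V -> R) (le : {set V} -> R) (h : R) (m : nat).
Implicit Types (u v w : V) (k : nat).

(* [ceil (dist v w / h)] truncated at [m], but with value 0 on the diagonal *)
Definition rdist v w : nat :=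
  find (fun k => (v == w) || `[< dist_le E lv le v w (k%:R * h) >]) (iota 0 m).

Hypotheses (lv_ge0 : forall x, 0 <= lv x) (le_ge0 : forall e, 0 <= le e).
Hypothesis h_ge0 : 0 <= h.

(** The predicate searched by [find] is monotone in its argument because [h] is nonnegative. So
    below the cap [m], bounding the first hit by [k] amounts to the predicate at [k]. *)
Lemma rdist_leP v w k :
  reflect [\/ (m <= k)%N, v = w | dist_le E lv le v w (k%:R * h)]
          (rdist v w <= k)%N.
Proof.
have [mk|km] := leqP m k.
  apply: (iffP idP) => _; first by constructor 1.
  by apply: leq_trans mk; rewrite -[leqRHS](size_iota 0) find_size.
rewrite -ltnS -has_take_leq ?size_iota // take_iota (minn_idPl km).
apply: (iffP hasP) => [[j]|[] //].
- rewrite mem_iota /= add0n ltnS => jk /orP[/eqP ->|/asboolP dj].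
    by constructor 2.
  by constructor 3; apply: dist_leW dj => //; rewrite ler_wpM2r // ler_nat.
- by move=> ->; exists 0%N; rewrite ?mem_iota ?eqxx.
- move=> dk; exists k; first by rewrite mem_iota /= add0n.
  by apply/orP; right; apply/asboolP.
Qed.

Lemma rdist_le_cap v w : (rdist v w <= m)%N.
Proof. by apply/rdist_leP; constructor 1. Qed.

Lemma rdistxx v : rdist v v = 0%N.
Proof. by apply/eqP; rewrite -leqn0; apply/rdist_leP; constructor 2. Qed.

Lemma rdistC v w : rdist v w = rdist w v.
Proof.
suff le_rdist x y : (rdist x y <= rdist y x)%N.
  by apply/eqP; rewrite eqn_leq !le_rdist.
apply/rdist_leP; have /rdist_leP[hm|->|hd] := leqnn (rdist y x).
- by constructor 1.
- by constructor 2.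
- by constructor 3; apply: dist_leC.
Qed.

(** Rounding up is subadditive, and truncation does no harm: once a distance on the right reaches
    [m], the bound is the trivial one. *)
Lemma rdist_triangle v u w : (rdist v w <= rdist v u + rdist u w)%N.
Proof.
have /rdist_leP[hm|->|hd] := leqnn (rdist v u); last 2 first.
- exact: leq_addl.
- have /rdist_leP[hm'|<-|hd'] := leqnn (rdist u w); last 2 first.
  + exact: leq_addr.
  + apply/rdist_leP; constructor 3; rewrite natrD mulrDl.
    exact: dist_le_trans hd hd'.
  by apply: leq_trans (leq_addl _ _); apply: leq_trans hm'; apply: rdist_le_cap.
by apply: leq_trans (leq_addr _ _); apply: leq_trans hm; apply: rdist_le_cap.
Qed.

End RoundedDistance.

Lemma rdistW (R : realType) (V : finType) (E : {set {set V}})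
    (lv lv' : V -> R) (le le' : {set V} -> R) h m v w :
  (forall x, 0 <= lv x) -> (forall e, 0 <= le e) -> 0 <= h ->
  (forall x, lv x <= lv' x) -> (forall e, e \in E -> le e <= le' e) ->
  (rdist E lv le h m v w <= rdist E lv' le' h m v w)%N.
Proof.
move=> lv0 le0 h0 hv he; apply/rdist_leP => //.
have /rdist_leP := leqnn (rdist E lv' le' h m v w).
case=> // [hm|->|hd]; [by constructor 1|by constructor 2|].
by constructor 3; apply: dist_leW hd.
Qed.

(** * Discounted ball masses *)

Section DiscountedMass.
Variables (R : realType) (V : finType).
Implicit Types (d : V -> V -> nat) (u v w : V).

Definition mass (q : R) d v : R := \sum_w q ^+ d v w.

Lemma mass_ge1 (q : R) d v : 0 <= q -> d v v = 0%N -> 1 <= mass q d v.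
Proof.
move=> q0 dvv; rewrite /mass (bigD1 v) //= dvv expr0 lerDl.
by apply: sumr_ge0 => w _; rewrite exprn_ge0.
Qed.

Lemma mass_le_card (q : R) d v : 0 <= q <= 1 -> mass q d v <= #|V|%:R.
Proof.
move=> q01; rewrite /mass -sum1_card natr_sum; apply: ler_sum => w _.
by case/andP: q01 => q0 q1; apply: exprn_ile1.
Qed.

Lemma ler_mass (q : R) d d' v : 0 <= q <= 1 ->
  (forall w, d v w <= d' v w)%N -> mass q d' v <= mass q d v.
Proof.
by move=> /andP[q0 q1] dd'; apply: ler_sum => w _; rewrite ler_wiXn2l.
Qed.

Variables (r : R) (p : nat) (d d' : V -> V -> nat) (u v : V).
Hypotheses (r01 : 0 <= r <= 1) (rp : r ^+ p * (2 * #|V|%:R) <= 1).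
Hypotheses (dxx' : forall x, d' x x = 0%N) (dC' : forall x y, d' x y = d' y x).
Hypothesis tri : forall x y z, (d x z <= d x y + d y z)%N.
Hypothesis tri' : forall x y z, (d' x z <= d' x y + d' y z)%N.
Hypothesis dd' : forall x y, (d x y <= d' x y)%N.
Hypotheses (duv : (d v u <= 1)%N) (duv' : (p < d' v u)%N).

(* Merging two balls that are far apart in [d'] but adjacent in [d] adds up their
   masses: no point is close to both centers, so the overlap is negligible. *)
Lemma mass_merge : mass (r ^+ 2) d' v + r ^+ 2 / 2 * mass (r ^+ 2) d' u
  <= mass (r ^+ 2) d v.
Proof.
have r0 : 0 <= r by case/andP: r01.
have ptw w : (r ^+ 2) ^+ d' v w + r ^+ 2 * (r ^+ 2) ^+ d' u w
    <= (r ^+ 2) ^+ d v w + r ^+ 2 * r ^+ p.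
  have := tri' v w u; rewrite (dC' w u) => hab.
  have := tri v u w; move: (dd' v w) (dd' u w) => h1 h2 h3.
  rewrite -exprS -!exprM -exprD.
  (* The centre nearer to [w] in [d'] yields the first term on the right. The farther one is at
     distance more than [p / 2], so its term is at most the error. When that is [v], the strictness
     of [ab] and [duv'] makes up for the missing factor [r ^+ 2]. *)
  have [ab|ba] := ltnP (d' u w) (d' v w).
    rewrite addrC; apply: lerD; apply: ler_wiXn2l => //; try lia; by case/andP: r01.
  apply: lerD; apply: ler_wiXn2l => //; try lia; by case/andP: r01.
have : \sum_w ((r ^+ 2) ^+ d' v w + r ^+ 2 * (r ^+ 2) ^+ d' u w)
    <= \sum_w ((r ^+ 2) ^+ d v w + r ^+ 2 * r ^+ p) by apply: ler_sum.
have sum_cst : \sum_(w : V) r ^+ 2 * r ^+ p = r ^+ 2 * r ^+ p * #|V|%:R.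
  by rewrite sumr_const mulr_natr.
rewrite !big_split /= -mulr_sumr sum_cst -/(mass _ d' u).
rewrite -/(mass _ d v) -/(mass _ d' v).
have q0 : 0 <= r ^+ 2 by apply: exprn_ge0.
(* By [rp] the summed error is at most [r ^+ 2 / 2], hence at most [r ^+ 2 / 2] times the mass at
   [u], which is at least 1. This costs half of the gain. *)
have := mass_ge1 q0 (dxx' u); move: rp q0.
move: (r ^+ 2) (mass _ d' u) (mass _ d v) (mass _ d' v) (r ^+ p) (#|V|%:R).
move=> q Zu Z0 Zv rr n h1 h2 h3 h4.
have := ler_wpM2l h2 h1; have := ler_wpM2l h2 h3; lra.
Qed.

End DiscountedMass.

(** For [q <= 1] the product of [1 - q / 4] and [1 + q / 2] is at least 1, so [x / y <= 1 - q / 4];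
    then [ln t <= t - 1] is applied to [t = x / y]. *)
Lemma ln_gain (R : realType) (q x y : R) : 0 <= q <= 1 -> 0 < x ->
  x + q / 2 * x <= y -> q / 4 <= ln y - ln x.
Proof.
move=> /andP[q0 q1] x0 xy.
have y0 : 0 < y by apply: lt_le_trans xy; rewrite ltr_pwDl // !mulr_ge0 ?invr_ge0 // ltW.
rewrite -ln_div ?posrE //.
have -> : ln (y / x) = - ln (x / y) by rewrite !ln_div ?posrE // opprB.
have xy0 : 0 < x / y by rewrite divr_gt0.
have lnxy : ln (1 + (x / y - 1)) <= x / y - 1 by apply: le_ln1Dx; lra.
rewrite addrC subrK in lnxy.
suff : x / y <= 1 - q / 4 by lra.
rewrite ler_pdivrMr //.
have : (1 - q / 4) * (x + q / 2 * x) <= (1 - q / 4) * y by apply: ler_wpM2l => //; lra.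
have : 0 <= q * (1 - q) * x by rewrite !mulr_ge0 ?subr_ge0 // ltW.
have : 0 <= q * x by rewrite mulr_ge0 // ltW.
nra.
Qed.

(** * The potential *)

Section Potential.
Variables (R : realType) (V : finType) (E : {set {set V}}) (h s r : R).
Implicit Types (lv : V -> R) (le : {set V} -> R) (u v w : V).

(* The first term pays for demands from a vertex to itself, which a cut separates
   by making that vertex longer than [h * s]. *)
Definition potential lv le v : R :=
  `[< dist_le E lv le v v h >]%:R
  + 8 / r ^+ 2 * ln (mass (r ^+ 2) (rdist E lv le h (Num.truncn s).+1) v).

Hypotheses (h_ge0 : 0 <= h) (s_ge1 : 1 <= s) (r_gt0 : 0 < r) (r_le1 : r <= 1).
Hypothesis r_small : r ^+ Num.truncn s * (2 * #|V|%:R) <= 1.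

Let q01 : 0 <= r ^+ 2 <= 1.
Proof. by have r0 := ltW r_gt0; rewrite exprn_ge0 // exprn_ile1. Qed.

Let q_gt0 : 0 < r ^+ 2.
Proof. exact: exprn_gt0. Qed.

Section Bounds.
Variables (lv : V -> R) (le : {set V} -> R).
Hypotheses (lv_ge0 : forall x, 0 <= lv x) (le_ge0 : forall e, 0 <= le e).
Let Z := mass (r ^+ 2) (rdist E lv le h (Num.truncn s).+1).

Lemma rmass_ge1 v : 1 <= Z v.
Proof. by apply: mass_ge1; [apply: ltW | apply: rdistxx]. Qed.

Lemma potential_ge0 v : 0 <= potential lv le v.
Proof.
by rewrite addr_ge0 // mulr_ge0 ?ln_ge0 ?rmass_ge1 // divr_ge0 // ltW.
Qed.

Lemma potential_le v : potential lv le v <= 1 + 8 / r ^+ 2 * ln #|V|%:R.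
Proof.
apply: lerD; first by rewrite lern1 leq_b1.
have Z0 := lt_le_trans ltr01 (rmass_ge1 v).
have ZV : Z v <= #|V|%:R by apply: mass_le_card.
rewrite ler_wpM2l ?divr_ge0 ?(ltW q_gt0) // ler_ln // posrE //.
exact: lt_le_trans ZV.
Qed.

End Bounds.

Section Cut.
Variables (lv lv' : V -> R) (le le' : {set V} -> R).
Hypotheses (lv_ge0 : forall x, 0 <= lv x) (le_ge0 : forall e, 0 <= le e).
Hypotheses (lv_le : forall x, lv x <= lv' x) (lv'_ge0 : forall x, 0 <= lv' x).
Hypotheses (le_le : forall e, e \in E -> le e <= le' e).
Hypothesis le'_ge0 : forall e, 0 <= le' e.

Let d := rdist E lv le h (Num.truncn s).+1.
Let d' := rdist E lv' le' h (Num.truncn s).+1.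

Lemma rmass_le v : mass (r ^+ 2) d' v <= mass (r ^+ 2) d v.
Proof. by apply: ler_mass => // w; apply: rdistW. Qed.

Lemma ln_rmass_le v : ln (mass (r ^+ 2) d' v) <= ln (mass (r ^+ 2) d v).
Proof.
by rewrite ler_ln ?rmass_le // posrE (lt_le_trans ltr01) // rmass_ge1.
Qed.

Lemma self_dist_le v : (`[< dist_le E lv' le' v v h >] <= `[< dist_le E lv le v v h >])%N.
Proof.
case: asboolP => // hd; case: asboolP => // hn; case: hn.
exact: dist_leW hd.
Qed.

Lemma ler_potential v : potential lv' le' v <= potential lv le v.
Proof.
apply: lerD; first by rewrite ler_nat self_dist_le.
by rewrite ler_wpM2l ?ln_rmass_le // divr_ge0 // ltW.
Qed.

Lemma potential_drop u v :
  dist_le E lv le u v h -> dist_gt E lv' le' u v (h * s) ->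
  2 <= (potential lv le u - potential lv' le' u)
       + (potential lv le v - potential lv' le' v).
Proof.
move=> hle /dist_gtP hgt.
(* For a self-demand the indicator in [potential] falls from 1 to 0, and this drop is counted twice
   since both ends are the same vertex. *)
have [uv|uv] := eqVneq u v.
  move: hle hgt; rewrite -uv => hle hgt.
  have := ln_rmass_le u; rewrite /potential.
  have -> : `[< dist_le E lv le u u h >] = true by apply/asboolP.
  have -> : `[< dist_le E lv' le' u u h >] = false.
    by apply/asboolP => hd; apply: hgt; apply: dist_leW hd => //; rewrite ler_peMr.
  have c0 : 0 <= 8 / r ^+ 2 by rewrite divr_ge0 // ltW.
  by move=> /(ler_wpM2l c0); rewrite -/d -/d' /=; lra.
have duv : (d v u <= 1)%N.
  by apply/rdist_leP => //; constructor 3; rewrite mul1r; apply: dist_leC.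
(* The cap lies one above [Num.truncn s], so truncation cannot hide that the distance exceeds
   [h * s]. *)
have duv' : (Num.truncn s < d' v u)%N.
  rewrite ltnNge; apply/negP => /rdist_leP; case=> //.
  - by rewrite ltnn.
  - by move=> vu; rewrite vu eqxx in uv.
  - move=> /(dist_leC lv'_ge0 le'_ge0) hd; apply: hgt; apply: dist_leW hd => //.
    by rewrite mulrC ler_wpM2l // truncn_le (le_trans ler01).
have r01 : 0 <= r <= 1 by rewrite ltW.
have dC x y : d x y = d y x by apply: rdistC.
have dC' x y : d' x y = d' y x by apply: rdistC.
have dxx' x : d' x x = 0%N by apply: rdistxx.
have tri x y z : (d x z <= d x y + d y z)%N by apply: rdist_triangle.
have tri' x y z : (d' x z <= d' x y + d' y z)%N by apply: rdist_triangle.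
have dd' x y : (d x y <= d' x y)%N by apply: rdistW.
have mv := mass_merge r01 r_small dxx' dC' tri tri' dd' duv duv'.
rewrite dC in duv; rewrite dC' in duv'.
have mu := mass_merge r01 r_small dxx' dC' tri tri' dd' duv duv'.
have Zgt0 x : 0 < mass (r ^+ 2) d' x by rewrite (lt_le_trans ltr01) // rmass_ge1.
suff : r ^+ 2 / 4 <= (ln (mass (r ^+ 2) d u) - ln (mass (r ^+ 2) d' u))
                    + (ln (mass (r ^+ 2) d v) - ln (mass (r ^+ 2) d' v)).
  have c0 : 0 <= 8 / r ^+ 2 by rewrite divr_ge0 // ltW.
  move=> /(ler_wpM2l c0).
  (* The factor 8 in [potential] is chosen to turn the gain [r ^+ 2 / 4] into 2. *)
  have -> : 8 / r ^+ 2 * (r ^+ 2 / 4) = 2 by field; rewrite gt_eqF.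
  rewrite /potential -/d -/d'.
  have := self_dist_le u; have := self_dist_le v.
  by rewrite -!(ler_nat R); lra.
(* The end with the smaller new mass gains a constant fraction of its own mass from the merge; the
   other logarithm does not increase under the cut. *)
have [Zuv|/ltW Zvu] := lerP (mass (r ^+ 2) d' u) (mass (r ^+ 2) d' v).
  rewrite -[leLHS]addr0; apply: lerD; last by rewrite subr_ge0 ln_rmass_le.
  apply: ln_gain => //; apply: le_trans mu; rewrite lerD2l ler_wpM2l //.
  by rewrite divr_ge0 // ltW.
rewrite -[leLHS]add0r; apply: lerD; first by rewrite subr_ge0 ln_rmass_le.
apply: ln_gain => //; apply: le_trans mv; rewrite lerD2l ler_wpM2l //.
by rewrite divr_ge0 // ltW.
Qed.

(** Each separated unit of demand is charged to a drop of 2 at its two ends. A vertex is charged at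
    most [A v] as a source and [A v] as a target, which cancels the 2. *)
Lemma sep_le_potential_drop (A : V -> R) (D : V -> V -> R) :
  demand D -> respecting A D -> h_length E lv le h D ->
  sep E lv' le' (h * s) D
    <= \sum_v A v * (potential lv le v - potential lv' le' v).
Proof.
move=> D0 DA Dh; set f := fun v => potential lv le v - potential lv' le' v.
have f0 v : 0 <= f v by rewrite subr_ge0 ler_potential.
have ptw u w : (if `[< dist_gt E lv' le' u w (h * s) >] then D u w else 0) * 2
    <= D u w * f u + D u w * f w.
  rewrite -mulrDr; case: asboolP => [hgt|_]; last first.
    by rewrite mul0r mulr_ge0 // addr_ge0.
  have [Dgt|] := ltP 0 (D u w).
    by rewrite ler_wpM2l // potential_drop //; apply: Dh.
  by move=> Dle; have -> : D u w = 0 by [apply/le_anti/andP]; rewrite !mul0r.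
rewrite -(ler_pM2r (ltr0n R 2)) [leRHS]mulr_natr mulr2n /sep mulr_suml.
apply: (@le_trans _ _ (\sum_u \sum_w (D u w * f u + D u w * f w))).
  by apply: ler_sum => u _; rewrite mulr_suml; apply: ler_sum.
under eq_bigr do rewrite big_split /=.
rewrite big_split /=; apply: lerD.
  apply: ler_sum => u _; rewrite -mulr_suml ler_wpM2r //.
  by case: (DA u).
rewrite exchange_big /=; apply: ler_sum => u _; rewrite -mulr_suml ler_wpM2r //.
by case: (DA u).
Qed.

End Cut.
End Potential.

(** * Composing moving cuts *)

Section CappedLengths.
Variables (R : realType) (V : finType) (E : {set {set V}}) (H : R).
Variables (lv lv' : V -> R) (le le' : {set V} -> R).
Hypotheses (lv'_ge0 : forall x, 0 <= lv' x) (le'_ge0 : forall e, 0 <= le' e).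
Hypothesis lv_cap : forall x, lv x = lv' x \/ H < lv' x.
Hypothesis le_cap : forall e, e \in E -> le e = le' e \/ H < le' e.

(** The two lengths differ only at elements whose second length alone exceeds [H], and one such
    element already makes the whole path longer than [H]. *)
Lemma plen_cap v p : path (adj E) v p ->
  plen lv le v p = plen lv' le' v p \/ H < plen lv' le' v p.
Proof.
elim: p v => [|x p IH] v /=; first by rewrite !plen_nil.
move=> /andP[/andP[_ /le_cap hx] /IH]; rewrite !plen_cons.
have := plen_ge lv'_ge0 le'_ge0 x p.
move: (lv_cap v) hx (lv'_ge0 v) (lv'_ge0 x) (le'_ge0 [set v; x]%SET).
by move=> [->|h1] [->|h2] h3 h4 h5 h6 [->|h7]; (by left) || (right; lra).
Qed.

Lemma dist_gt_cap u v : dist_gt E lv le u v H -> dist_gt E lv' le' u v H.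
Proof. by move=> hgt p sp; have := hgt _ sp; case: sp => /plen_cap[->|]. Qed.

End CappedLengths.

Lemma sep_le (R : realType) (V : finType) (E : {set {set V}})
    (lv lv' : V -> R) (le le' : {set V} -> R) (H : R) (D : V -> V -> R) :
  demand D ->
  (forall u v, dist_gt E lv le u v H -> dist_gt E lv' le' u v H) ->
  sep E lv le H D <= sep E lv' le' H D.
Proof.
move=> D0 hgt; apply: ler_sum => u _; apply: ler_sum => w _.
case: asboolP => [/hgt hd|_]; first by case: asboolP.
by case: asboolP.
Qed.

Section CappedCut.
Variables (R : realType) (H : R).
Hypothesis H_gt0 : 0 < H.
Implicit Types (c : R) (k : nat).

(** Numerator over [H] of the sum of the cut values [k / H] and [c], capped because cut values are
    at most 1. The cap is [Num.truncn H] since [H] need not be an integer. *)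
Definition capped_add k c : nat := minn (Num.truncn H) (k + Num.truncn (H * c)).

Lemma truncn_cutK c : (exists j : nat, c = j%:R / H) -> (Num.truncn (H * c))%:R = H * c.
Proof. by move=> [j ->]; rewrite mulrC divfK ?gt_eqF // natrK. Qed.

(** A capped value adds [Num.truncn H] rather than [H]; the original length, at least 1, makes up
    for the lost fraction. *)
Lemma capped_addP (l : R) k c : 1 <= l -> (exists j : nat, c = j%:R / H) ->
  l + H * (k%:R / H) + H * c = l + H * ((capped_add k c)%:R / H)
  \/ H < l + H * ((capped_add k c)%:R / H).
Proof.
move=> l1 cj; rewrite ![H * (_ / H)]mulrC !divfK ?gt_eqF // /capped_add.
case: leqP => _; last by left; rewrite natrD truncn_cutK // addrA.
by right; have := truncnS_gt H; rewrite -natr1; lra.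
Qed.

Lemma capped_add_ge k c : (k <= Num.truncn H)%N -> (k <= capped_add k c)%N.
Proof. by move=> kH; rewrite leq_min kH leq_addr. Qed.

Lemma capped_add_le k c : (exists j : nat, c = j%:R / H) ->
  (capped_add k c)%:R / H <= k%:R / H + c.
Proof.
move=> cj; rewrite -(ler_pM2r H_gt0) mulrDl !divfK ?gt_eqF // [c * H]mulrC.
by rewrite -truncn_cutK // -natrD ler_nat geq_minr.
Qed.

End CappedCut.

(** * Cuts of minimum total cost *)

Section MinimumCut.
Variables (R : realType) (V : finType) (E : {set {set V}}).
Variables (lV uV : V -> nat) (lE uE : {set V} -> nat).
Variables (A : V -> R) (h s r phi : R).
Hypotheses (lV_gt0 : forall v, (0 < lV v)%N).
Hypotheses (lE_gt0 : forall e, e \in E -> (0 < lE e)%N).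
Hypothesis A_ge0 : forall v, 0 <= A v.
Hypotheses (h_gt0 : 0 < h) (s_ge1 : 1 <= s) (phi_gt0 : 0 < phi).
Hypotheses (r_gt0 : 0 < r) (r_le1 : r <= 1).
Hypothesis r_small : r ^+ Num.truncn s * (2 * #|V|%:R) <= 1.

Let H := h * s.
Let H_gt0 : 0 < H.
Proof. by rewrite mulr_gt0 // (lt_le_trans ltr01). Qed.

Let lv v : R := (lV v)%:R.
Let le e : R := (lE e)%:R.
Let uv v : R := (uV v)%:R.
Let ue e : R := (uE e)%:R.

(* [k] stands for the cut values [k / H]; there are finitely many, so that the cost
   attains its minimum. *)
Let cut := ({ffun V -> 'I_(Num.truncn H).+1}
            * {ffun {set V} -> 'I_(Num.truncn H).+1})%type.
Implicit Type k : cut.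

Let CV k v : R := (k.1 v : nat)%:R / H.
Let CE k e : R := (k.2 e : nat)%:R / H.
Let lvC k := cutV H lv (CV k).
Let leC k := cutE H le (CE k).
Let size k := cut_size E uv ue (CV k) (CE k).
Let pot k v := potential E h s r (lvC k) (leC k) v.
Let cost k := size k + phi * \sum_v A v * pot k v.

Let ord_cut (x : 'I_(Num.truncn H).+1) :
  (exists j : nat, (x : nat)%:R / H = j%:R / H) /\ 0 <= (x : nat)%:R / H <= 1.
Proof.
split; first by exists x.
rewrite divr_ge0 ?ler0n ?(ltW H_gt0) // ler_pdivrMr // mul1r.
apply: le_trans (_ : (Num.truncn H)%:R <= H); last by rewrite truncn_le ltW.
by rewrite ler_nat -ltnS.
Qed.

Let moving_cut_ord k : moving_cut E H (CV k) (CE k).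
Proof. by split=> [v|e _]; apply: ord_cut. Qed.

Let lvC_ge0 k v : 0 <= lvC k v.
Proof. by rewrite addr_ge0 // mulr_ge0 ?divr_ge0 ?(ltW H_gt0). Qed.

Let leC_ge0 k e : 0 <= leC k e.
Proof. by rewrite addr_ge0 // mulr_ge0 ?divr_ge0 ?(ltW H_gt0). Qed.

Let size_ge0 k : 0 <= size k.
Proof.
by rewrite addr_ge0 // sumr_ge0 // => *; rewrite mulr_ge0 ?divr_ge0 ?(ltW H_gt0).
Qed.

(** The default value of [inord] never occurs, as [capped_add] is at most [Num.truncn H]. *)
Let add_cut k (CV' : V -> R) (CE' : {set V} -> R) : cut :=
  ([ffun v => inord (capped_add H (k.1 v) (CV' v))],
   [ffun e => inord (capped_add H (k.2 e) (CE' e))]).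

Let CV_add k CV' CE' v :
  CV (add_cut k CV' CE') v = (capped_add H (k.1 v) (CV' v))%:R / H.
Proof. by rewrite /CV ffunE inordK // ltnS geq_minl. Qed.

Let CE_add k CV' CE' e :
  CE (add_cut k CV' CE') e = (capped_add H (k.2 e) (CE' e))%:R / H.
Proof. by rewrite /CE ffunE inordK // ltnS geq_minl. Qed.

Let size_add k CV' CE' : moving_cut E H CV' CE' ->
  size (add_cut k CV' CE') <= size k + cut_size E uv ue CV' CE'.
Proof.
move=> [mV mE]; rewrite /size /cut_size addrACA -!big_split /=.
apply: lerD; apply: ler_sum => x xP; rewrite -mulrDr ler_wpM2l //.
  by rewrite CE_add capped_add_le //; case: (mE x xP).
by rewrite CV_add capped_add_le //; case: (mV x).
Qed.

(* A sparse cut on top of [k] would decrease the cost. *)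
Lemma min_cost_expanding k : (forall k', cost k <= cost k') ->
  expanding E (lvC k) (leC k) uv ue A h s phi.
Proof.
move=> kmin CV' CE' D mC D0 DA Dh sep0.
rewrite -/H ler_pdivlMr // leNgt; apply/negP => sparse.
have := kmin (add_cut k CV' CE'); apply/negP; rewrite -ltNge.
set k' := add_cut k CV' CE'; have [mV mE] := mC.
have natM (x : 'I_(Num.truncn H).+1) : (x <= Num.truncn H)%N by rewrite -ltnS.
have lv_le v : lvC k v <= lvC k' v.
  rewrite lerD2l (ler_pM2l H_gt0) CV_add ler_pM2r ?invr_gt0 //.
  by rewrite ler_nat capped_add_ge.
have le_le e : e \in E -> leC k e <= leC k' e.
  move=> _; rewrite lerD2l (ler_pM2l H_gt0) CE_add ler_pM2r ?invr_gt0 //.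
  by rewrite ler_nat capped_add_ge.
(* Every pair separated by the new cut on top of [k] stays separated by the capped sum [k']. *)
have sepk' : sep E (cutV H (lvC k) CV') (cutE H (leC k) CE') H D
    <= sep E (lvC k') (leC k') H D.
  apply: sep_le => // u v; apply: dist_gt_cap => // [x|e eE].
    rewrite /lvC /cutV CV_add; apply: capped_addP => //; last by case: (mV x).
    by rewrite ler1n lV_gt0.
  rewrite /leC /cutE CE_add; apply: capped_addP => //; last by case: (mE e eE).
  by rewrite ler1n lE_gt0.
have drop := sep_le_potential_drop (ltW h_gt0) s_ge1 r_gt0 r_le1 r_small
  (lvC_ge0 k) (leC_ge0 k) lv_le (lvC_ge0 k') le_le (leC_ge0 k') D0 DA Dh.
have := size_add k mC; rewrite -/k' => szk'.
rewrite /cost; move: drop; under eq_bigr do rewrite mulrBr.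
rewrite sumrB -/H -/(pot _ _).
(* The potential term falls by at least [phi] times the separation, which by [sparse] exceeds the
   added size. *)
move=> /(le_trans sepk') /(ler_wpM2l (ltW phi_gt0)); rewrite mulrBr.
by move: sparse szk'; rewrite /pot; lra.
Qed.

Lemma exists_expanding_cut : exists (CV : V -> R) (CE : {set V} -> R),
  [/\ moving_cut E H CV CE,
      cut_size E uv ue CV CE
        <= phi * (1 + 8 / r ^+ 2 * ln #|V|%:R) * weight A
    & expanding E (cutV H lv CV) (cutE H le CE) uv ue A h s phi].
Proof.
pose k0 : cut := ([ffun=> ord0], [ffun=> ord0]).
have [k kmin] : exists k, forall k', cost k <= cost k'.
  exists [arg min_(k < k0) cost k]%O.
  by case: arg_minP => // k _ kmin k'; apply: kmin.
exists (CV k), (CE k); split; [exact: moving_cut_ord | | exact: min_cost_expanding].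
have sz0 : size k0 = 0.
  rewrite /size /cut_size !big1 ?addr0 // => *; first by rewrite /CV ffunE mul0r mulr0.
  by rewrite /CE ffunE mul0r mulr0.
have pot_ge0 : 0 <= phi * \sum_v A v * pot k v.
  rewrite mulr_ge0 ?(ltW phi_gt0) // sumr_ge0 // => v _.
  by rewrite mulr_ge0 // potential_ge0 // ltW.
(* The size of [k] is at most its cost, hence at most the cost of the zero cut, which is pure
   potential. *)
apply: (@le_trans _ _ (cost k)); first by rewrite lerDl.
apply: le_trans (kmin k0) _; rewrite /cost sz0 add0r -mulrA ler_pM2l //.
rewrite mulr_sumr; apply: ler_sum => v _; rewrite mulrC ler_wpM2r //.
by apply: potential_le => //; apply: ltW.
Qed.

End MinimumCut.

(** * Choice of the discount and the final constants *)

(** Take [r = (2 n) ^ (- 2 / s)]. As [s >= 1], [Num.truncn s] is at least [s / 2], so its power of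
    [r] is at most [1 / (2 n)]. The 16 bounds [2 ^ (4 / s)]. *)
Lemma exists_discount (R : realType) (n : nat) (s : R) : (0 < n)%N -> 1 <= s ->
  exists r : R, [/\ 0 < r, r <= 1, r ^+ Num.truncn s * (2 * n%:R) <= 1
                  & (r ^+ 2)^-1 <= 16 * n%:R `^ (4 / s)].
Proof.
move=> n0 s1; have s0 : 0 < s := lt_le_trans ltr01 s1.
have n1 : 1 <= n%:R :> R by rewrite ler1n.
set x : R := 2 * n%:R; have x1 : 1 <= x by rewrite /x; lra.
have x0 : 0 < x := lt_le_trans ltr01 x1.
have y0 : 0 < x `^ (2 / s) by apply: powR_gt0.
exists (x `^ (2 / s))^-1; split.
- by rewrite invr_gt0.
- by rewrite invf_le1 // -[leLHS](powRr0 x) ler_powR // divr_ge0 // ltW.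
- rewrite exprVn mulrC ler_pdivrMr ?exprn_gt0 // mul1r.
  rewrite -powR_mulrn ?powR_ge0 // -powRrM -[leLHS](powRr1 (ltW x0)) ler_powR //.
  rewrite mulrAC ler_pdivlMr // mul1r.
  have := truncnS_gt s; rewrite -natr1.
  have : 1 <= (Num.truncn s)%:R :> R by rewrite ler1n truncn_gt0.
  lra.
- rewrite exprVn invrK -powR_mulrn ?powR_ge0 // -powRrM /x powRM //.
  have -> : 2 / s * 2%:R = 4 / s by ring.
  rewrite ler_wpM2r ?powR_ge0 //.
  apply: (@le_trans _ _ (2 `^ 4)).
    by apply: ler_powR; rewrite ?ler_pdivrMr //; lra.
  by rewrite powR_mulrn //; lra.
Qed.

Theorem theorem4p1 (R : realType) (c0 cN : R) :
  0 < c0 -> 0 < cN ->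
  exists K : R, 0 < K /\
  forall (V : finType) (E : {set {set V}})
         (lV : V -> nat) (lE : {set V} -> nat)
         (uV : V -> nat) (uE : {set V} -> nat)
         (A : V -> R) (h phi s : R),
    is_edge_set E ->
    (forall v, (0 < lV v)%N /\ (lV v)%:R <= (#|V|%:R : R) `^ cN) ->
    (forall e, e \in E -> (0 < lE e)%N /\ (lE e)%:R <= (#|V|%:R : R) `^ cN) ->
    (forall v, (0 < uV v)%N /\ (uV v)%:R <= (#|V|%:R : R) `^ cN) ->
    (forall e, e \in E -> (0 < uE e)%N /\ (uE e)%:R <= (#|V|%:R : R) `^ cN) ->
    node_weighting A ->
    1 < h -> 0 < phi -> phi < 1 -> 1 <= s -> s <= c0 * ln (#|V|%:R : R) ->
    exists (CV : V -> R) (CE : {set V} -> R),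
      [/\ moving_cut E (h * s) CV CE,
          cut_size E (fun v => (uV v)%:R) (fun e => (uE e)%:R) CV CE
            <= K * (#|V|%:R : R) `^ (K / s) * ln (#|V|%:R : R) * phi * weight A
        & expanding E
            (cutV (h * s) (fun v => (lV v)%:R) CV)
            (cutE (h * s) (fun e => (lE e)%:R) CE)
            (fun v => (uV v)%:R) (fun e => (uE e)%:R) A h s phi].
Proof.
(* Here 128 is 8 times 16, from [8 / r ^+ 2] and [exists_discount]. The summand [c0] absorbs the
   additive 1 of the potential bound, since [1 <= s <= c0 * ln n]; this also forces [n > 1]. *)
move=> c0_gt0 _; exists (c0 + 128); split; first by lra.
move=> V E lV lE uV uE A h phi s _ hlV hlE _ _ A0 h1 phi0 _ s1 sln.
set n : R := #|V|%:R in sln *.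
have ln_gt0 : 0 < ln n by rewrite -(pmulr_rgt0 _ c0_gt0); lra.
have n_gt1 : 1 < n by rewrite ltNge; apply/negP => /ln_le0; rewrite leNgt ln_gt0.
have card_gt0 : (0 < #|V|)%N by rewrite -(ltr0n R) (lt_trans ltr01).
have [r [r0 r1 rs rn]] := exists_discount card_gt0 s1.
have h0 : 0 < h by lra.
have lV0 v : (0 < lV v)%N by case: (hlV v).
have lE0 e : e \in E -> (0 < lE e)%N by move=> /hlE[].
have [CV [CE [mC szC exC]]] :=
  exists_expanding_cut uV uE lV0 lE0 A0 h0 s1 phi0 r0 r1 rs.
exists CV, CE; split=> //; apply: le_trans szC _.
rewrite [X in _ <= X * _]mulrC ler_wpM2r ?sumr_ge0 // ler_wpM2l ?(ltW phi0) //.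
rewrite -/n in rn *; set N := n `^ ((c0 + 128) / s).
have N1 : 1 <= N.
  by rewrite -[leLHS](powRr0 n) ler_powR ?ltW // divr_gt0 //; lra.
have NN : n `^ (4 / s) <= N.
  by rewrite ler_powR ?(ltW n_gt1) // ler_wpM2r ?invr_ge0; lra.
have t1 : c0 * ln n <= c0 * ln n * N by rewrite ler_peMr // mulr_ge0 // ltW.
have t2 : 8 / r ^+ 2 * ln n <= 128 * N * ln n by rewrite ler_wpM2r ?(ltW ln_gt0) //; lra.
lra.
Qed.
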